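(* Let $(\mathbb{X},\|\cdot\|)$ be an infinite-dimensional real Banach space, let $\mathcal{B}=(e_n)_{n=1}^\infty$ be a normalized Schauder basis of $\mathbb{X}$, and let $0<t\le1$. Then $\mathcal{B}$ has the $t$-PCCG property if and only if $\mathcal{B}$ is $t$-greedy.
   Context: Let $(e_n^* )_{n=1}^\infty$ be the biorthogonal functionals of the normalized ($\|e_n\|=1$) Schauder basis $\mathcal{B}$. For a finite set $A\subset\mathbb{N}$ write $|A|$ for its cardinality and $P_A(x)=\sum_{n\in A}e_n^*(x)e_n$; for signs $\eta=(\eta_n)_{n\in A}$ with $\eta_n\in\{\pm1\}$ write $1_{\eta A}=\sum_{n\in A}\eta_n e_n$. The symbol $[\,\cdot\,]$ denotes linear span and $d(x,Y)=\inf_{y\in Y}\|x-y\|$. For $x\in\mathbb{X}$ and $m\in\mathbb{N}$, let $\mathscr{G}(x,t,m)$ be the collection of sets $\Gamma\subset\mathbb{N}$ with $|\Gamma|=m$ and $\min_{n\in\Gamma}|e_n^*(x)|\ge t\max_{n\notin\Gamma}|e_n^*(x)|$. Put $$\sigma_m(x)=\inf\{d(x,[e_n:n\in A]):A\subset\mathbb{N},\ |A|=m\},$$ $$\mathcal{D}_m(x)=\inf\{d(x,[1_{\eta A}]):A\subset\mathbb{N},\ \eta\in\{\pm1\}^A,\ |A|\le m\}.$$ $\mathcal{B}$ is $t$-greedy if there is a constant $C(t)>0$ such that $\|x-P_\Gamma(x)\|\le C(t)\sigma_m(x)$ for all $x\in\mathbb{X}$, $m\in\mathbb{N}$ and $\Gamma\in\mathscr{G}(x,t,m)$.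 $\mathcal{B}$ has the $t$-PCCG property if there is a constant $D(t)>0$ such that $\|x-P_\Gamma(x)\|\le D(t)\mathcal{D}_m(x)$ for all $x\in\mathbb{X}$, $m\in\mathbb{N}$ and $\Gamma\in\mathscr{G}(x,t,m)$. *)

(* Defs.v *)
From HB Require Import structures.
From mathcomp Require Import all_boot all_order all_algebra finmap.
From mathcomp Require Import all_classical all_reals all_analysis.
Import Order.TTheory GRing.Theory Num.Theory.
Import numFieldNormedType.Exports.

Set Implicit Arguments.
Unset Strict Implicit.
Unset Printing Implicit Defensive.

Local Open Scope classical_set_scope.
Local Open Scope fset_scope.
Local Open Scope ring_scope.

Section SchauderBases.
Context {R : realType} {X : normedModType R}.

Definition lin_span (S : set X) : set X :=
  [set y | exists (n : nat) (v : 'I_n -> X) (a : 'I_n -> R),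
     (forall i, S (v i)) /\ y = \sum_(i < n) a i *: v i].

Definition infinite_dimensional : Prop :=
  ~ exists A : set X, finite_set A /\ lin_span A = [set: X].

(* Bases are indexed from 0, i.e. [e n] is the vector e_(n+1) of the usual
   numbering by positive integers. *)
Definition expands (e : nat -> X) (x : X) (a : nat -> R) : Prop :=
  series (fun n => a n *: e n) @ \oo --> x.

Definition schauder_basis (e : nat -> X) : Prop :=
  forall x : X, exists! a : nat -> R, expands e x a.

Definition normalized (e : nat -> X) : Prop := forall n, `|e n| = 1.

(* [biorth e n] is the biorthogonal functional e_n^*; it takes junk values when
   [e] is not a Schauder basis. *)
Definition biorth (e : nat -> X) (n : nat) (x : X) : R :=
  xget (fun=> 0) [set a | expands e x a] n.

Definition basis_proj (e : nat -> X) (A : {fset nat}) (x : X) : X :=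
  \sum_(n <- A) biorth e n x *: e n.

Definition signs (A : {fset nat}) (eta : nat -> R) : Prop :=
  forall n, n \in A -> eta n = 1 \/ eta n = -1.

Definition indicator (e : nat -> X) (eta : nat -> R) (A : {fset nat}) : X :=
  \sum_(n <- A) eta n *: e n.

Definition dist (x : X) (Y : set X) : R := inf [set `|x - y| | y in Y].

Definition sigma (e : nat -> X) (m : nat) (x : X) : R :=
  inf [set dist x (lin_span [set e n | n in [set` A]])
      | A in [set A : {fset nat} | #|` A| = m]].

Definition pccg_error (e : nat -> X) (m : nat) (x : X) : R :=
  inf [set d | exists (A : {fset nat}) (eta : nat -> R),
    [/\ (#|` A| <= m)%N, signs A eta &
        d = dist x (lin_span [set indicator e eta A])]].

(* The real-valued [inf] and [sup] are the intended min and max only for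
   nonempty bounded sets; hence this is used only for m > 0, for which Gamma is
   nonempty. The coordinates of x along a normalized Schauder basis tend to 0,
   so the supremum over the complement of Gamma is attained. *)
Definition greedy_set (e : nat -> X) (x : X) (t : R) (m : nat)
    (Gamma : {fset nat}) : Prop :=
  #|` Gamma| = m /\
  t * sup [set `|biorth e n x| | n in ~` [set` Gamma]]
    <= inf [set `|biorth e n x| | n in [set` Gamma]].

Definition t_greedy (t : R) (e : nat -> X) : Prop :=
  exists2 C : R, 0 < C &
    forall (x : X) (m : nat) (Gamma : {fset nat}), (0 < m)%N ->
      greedy_set e x t m Gamma ->
      `|x - basis_proj e Gamma x| <= C * sigma e m x.

Definition t_PCCG (t : R) (e : nat -> X) : Prop :=
  exists2 D : R, 0 < D &
    forall (x : X) (m : nat) (Gamma : {fset nat}), (0 < m)%N ->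
      greedy_set e x t m Gamma ->
      `|x - basis_proj e Gamma x| <= D * pccg_error e m x.

End SchauderBases.

Arguments infinite_dimensional {R} X.

(* Main.v *)
(* A t-greedy basis has the t-PCCG property because sigma_m <= D_m.
   Conversely, the t-PCCG property makes the basis suppression unconditional
   (apply it to x + c 1_A with c large, whose t-greedy set A leaves the residual
   x - P_A x) and democratic on disjoint sets (apply it to 1_(aA) + 1_(bB)). If
   Gamma is a t-greedy set of x and y is supported in A with |A| = |Gamma|, then
   x - P_Gamma x is the part of x - y off A u Gamma plus the part of x on
   A \ Gamma. Unconditionality bounds the first part by |x - y|. As mu, the least
   modulus of a coordinate of x on Gamma, is at least t times each coordinate on
   A \ Gamma, unconditionality and democracy bound the second part by a multiple
   of the part of x on Gamma \ A, where x coincides with x - y. *)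

Require Import Defs.
From mathcomp Require Import all_boot all_order all_algebra finmap.
From mathcomp Require Import all_classical all_reals all_analysis.
From mathcomp Require Import ring lra.
Import Order.TTheory GRing.Theory Num.Theory.
Import numFieldNormedType.Exports.

Set Implicit Arguments.
Unset Strict Implicit.
Unset Printing Implicit Defensive.

Local Open Scope classical_set_scope.
Local Open Scope fset_scope.
Local Open Scope ring_scope.

(** [sigma] ranges over sets of exactly [m] indices, [pccg_error] over sets of at most [m]; padding
    a set reconciles the two. *)
Lemma fset_nat_extend (A : {fset nat}) (m : nat) :
  (#|` A| <= m)%N -> exists2 B : {fset nat}, A `<=` B & #|` B| = m.
Proof.
move=> /subnKC <-; elim: (m - #|` A|)%N => [|k [B AB cB]].
  by exists A; rewrite ?addn0.
have [n nB] : exists n, n \notin B.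
  exists (\max_(i <- B) i).+1; apply/negP => nB.
  by have := leq_bigmax_seq (P := xpredT) (F := id) _ nB isT; rewrite ltnn.
exists (n |` B); first by rewrite (fsubset_trans AB) // fsubsetU1.
by rewrite cardfsU1 nB cB addnS.
Qed.

(** * Distances to spans and the two approximation errors *)

Section Coordinates.
Context {R : realType} {X : normedModType R} (e : nat -> X).

Lemma dist_ge0 (x : X) (Y : set X) : 0 <= dist x Y.
Proof.
rewrite /dist; have [->|/set0P Y0] := eqVneq Y set0.
  by rewrite image_set0 inf0.
apply: lb_le_inf; first by case: Y0 => y Yy; exists `|x - y|, y.
by move=> _ [y _ <-].
Qed.

Lemma dist_le (x y : X) (Y : set X) : Y y -> dist x Y <= `|x - y|.
Proof.
move=> Yy; apply: ge_inf; last by exists y.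
by exists 0 => _ [z _ <-].
Qed.

Lemma ge_dist (x : X) (Y : set X) (d : R) :
  Y !=set0 -> (forall y, Y y -> d <= `|x - y|) -> d <= dist x Y.
Proof.
move=> [y Yy] dY; apply: lb_le_inf; first by exists `|x - y|, y.
by move=> _ [z Yz <-]; exact: dY.
Qed.

Lemma lin_span0 (S : set X) : lin_span S 0.
Proof.
exists 0%N, (fun=> 0), (fun=> 0); split; first by case.
by rewrite big_ord0.
Qed.

Lemma lin_span1 (c : R) (v : X) : lin_span [set v] (c *: v).
Proof.
exists 1%N, (fun=> v), (fun=> c); split => //.
by rewrite big_ord1.
Qed.

Lemma sigma_le (m : nat) (A : {fset nat}) (x y : X) :
  (#|` A| <= m)%N -> lin_span [set e n | n in [set` A]] y ->
  sigma e m x <= `|x - y|.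
Proof.
move=> Am Ay; have [B AB Bm] := fset_nat_extend Am.
apply: (@le_trans _ _ (dist x (lin_span [set e n | n in [set` B]]))).
  apply: ge_inf; last by exists B.
  by exists 0 => _ [C _ <-]; exact: dist_ge0.
apply: dist_le; case: Ay => k [v [a [va ->]]]; exists k, v, a; split => // i.
by have [n nA <-] := va i; exists n => //; exact: (fsubsetP AB).
Qed.

Lemma ge_sigma (m : nat) (x : X) (d : R) :
  (forall (A : {fset nat}) y, #|` A| = m ->
     lin_span [set e n | n in [set` A]] y -> d <= `|x - y|) ->
  d <= sigma e m x.
Proof.
move=> dA; apply: lb_le_inf.
  have [//|B _ Bm] := @fset_nat_extend fset0 m.
  by exists (dist x (lin_span [set e n | n in [set` B]])), B.
move=> _ [A Am <-]; apply: ge_dist; first by exists 0; exact: lin_span0.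
by move=> y; exact: dA.
Qed.

Lemma pccg_error_le (m : nat) (A : {fset nat}) (eta : nat -> R) (c : R) (x : X) :
  (#|` A| <= m)%N -> signs A eta ->
  pccg_error e m x <= `|x - c *: indicator e eta A|.
Proof.
move=> Am sA.
apply: (@le_trans _ _ (dist x (lin_span [set indicator e eta A]))).
  apply: ge_inf; last by exists A, eta.
  by exists 0 => _ [B [b [_ _ ->]]]; exact: dist_ge0.
by apply: dist_le; exact: lin_span1.
Qed.

Lemma ge_pccg_error (m : nat) (x : X) (d : R) :
  (forall (A : {fset nat}) eta y, (#|` A| <= m)%N -> signs A eta ->
     lin_span [set indicator e eta A] y -> d <= `|x - y|) ->
  d <= pccg_error e m x.
Proof.
move=> dA; apply: lb_le_inf.
  exists (dist x (lin_span [set indicator e (fun=> 1) fset0])).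
  by exists fset0, (fun=> 1); split.
move=> _ [A [eta [Am sA ->]]]; apply: ge_dist; first by exists 0; exact: lin_span0.
by move=> y; exact: dA.
Qed.

(** Multiples of [indicator e eta A] lie in the span of the [e n] with [n] in [A], and [sigma_le]
    accepts sets with fewer than [m] elements. *)
Lemma sigma_le_pccg_error (m : nat) (x : X) : sigma e m x <= pccg_error e m x.
Proof.
apply: ge_pccg_error => A eta _ Am _ [k [v [a [vA ->]]]].
apply: (sigma_le _ Am); rewrite (eq_bigr (fun i => a i *: indicator e eta A)).
  rewrite -scaler_suml scaler_sumr (big_nth 0%N) big_mkord.
  exists (size A), (fun i => e (nth 0%N A i)).
  exists (fun i => (\sum_i a i) * eta (nth 0%N A i)); split.
    by move=> i; exists (nth 0%N A i) => //=; rewrite mem_nth.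
  by apply: eq_bigr => i _; rewrite scalerA.
by move=> i _; rewrite vA.
Qed.

(** * Coordinate functionals of a Schauder basis *)

Hypothesis basis : schauder_basis e.

Lemma biorthP (x : X) : expands e x (biorth e ^~ x).
Proof.
have [a [ax _]] := basis x.
exact: (@xgetPex _ (fun=> 0) [set a | expands e x a] (ex_intro _ a ax)).
Qed.

Lemma biorth_unique (x : X) (a : nat -> R) (n : nat) :
  expands e x a -> biorth e n x = a n.
Proof.
move=> ax; have [b [_ bP]] := basis x.
by rewrite -(bP _ ax) (bP _ (@biorthP x)).
Qed.

(** Both vectors are limits of the same series. The vector identities below are reduced by this
    lemma to case analyses on coordinates. *)
Lemma biorth_inj (x y : X) : (forall n, biorth e n x = biorth e n y) -> x = y.
Proof.
move=> xy; have := @biorthP x; rewrite (funext xy) => yx.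
exact: (cvg_unique (@norm_hausdorff _ X) yx (@biorthP y)).
Qed.

Lemma biorth_linear (c : R) (x y : X) (n : nat) :
  biorth e n (c *: x + y) = c * biorth e n x + biorth e n y.
Proof.
apply: (@biorth_unique _ (fun n => c * biorth e n x + biorth e n y)).
rewrite /expands.
have -> : (fun n => (c * biorth e n x + biorth e n y) *: e n) =
    c *: (fun n => biorth e n x *: e n) + (fun n => biorth e n y *: e n).
  by apply/funext => k; rewrite scalerDl -scalerA.
rewrite seriesD seriesZ; apply: cvgD; last exact: biorthP.
by apply: cvgZl_tmp; exact: biorthP.
Qed.

Lemma biorthD (n : nat) (x y : X) :
  biorth e n (x + y) = biorth e n x + biorth e n y.
Proof. by have := biorth_linear 1 x y n; rewrite scale1r mul1r. Qed.

Lemma biorth0 (n : nat) : biorth e n 0 = 0.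
Proof. by apply: (addrI (biorth e n 0)); rewrite -biorthD !addr0. Qed.

Lemma biorthZ (n : nat) (c : R) (x : X) :
  biorth e n (c *: x) = c * biorth e n x.
Proof. by have := biorth_linear c x 0 n; rewrite biorth0 !addr0. Qed.

Lemma biorthB (n : nat) (x y : X) :
  biorth e n (x - y) = biorth e n x - biorth e n y.
Proof. by rewrite biorthD -scaleN1r biorthZ mulN1r. Qed.

Lemma biorth_basis (n k : nat) : biorth e n (e k) = (n == k)%:R.
Proof.
apply: (@biorth_unique _ (fun n => (n == k)%:R)).
apply: cvg_near_cst; exists k.+1 => // m /= km.
rewrite /series /= big_mkord.
rewrite (bigD1 (Ordinal km)) //= eqxx scale1r big1 ?addr0 // => i ik.
by rewrite -[_ == k]/(i == Ordinal km) (negPf ik) scale0r.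
Qed.

Lemma biorth_indicator (n : nat) (a : nat -> R) (A : {fset nat}) :
  biorth e n (indicator e a A) = if n \in A then a n else 0.
Proof.
rewrite /indicator (big_morph _ (biorthD n) (biorth0 n)).
under eq_bigr do rewrite biorthZ biorth_basis.
case: ifP => nA; last first.
  rewrite big_seq big1 // => i iA; case: eqP => [ni|_]; last by rewrite mulr0.
  by rewrite ni iA in nA.
rewrite (bigD1_seq n) ?fset_uniq //= eqxx mulr1 big1 ?addr0 // => i.
by rewrite eq_sym => /negPf ->; rewrite mulr0.
Qed.

End Coordinates.

(** * Greedy sets and vectors with finitely many coordinates *)

Section Democracy.
Context {R : realType} {X : normedModType R} (e : nat -> X) (t : R).
Hypotheses (basis : schauder_basis e) (enorm : normalized e).

(** The terms of the convergent expansion tend to 0, and their norms are the moduli of the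
    coordinates because the basis is normalized. *)
Lemma biorth_bounded (x : X) : exists M : R, forall n, `|biorth e n x| <= M.
Proof.
have cx : cvgn (series (fun n => biorth e n x *: e n)).
  by apply/cvg_ex; exists x; exact: biorthP.
have [M [_ Mx]] : bounded_fun (fun n => biorth e n x *: e n).
  by apply: cvg_seq_bounded; apply/cvg_ex; exists 0; exact: cvg_series_cvg_0.
exists (M + 1) => n; have := Mx (M + 1) _ n I; rewrite /= normrZ enorm mulr1.
by apply; rewrite ltrDl.
Qed.

Lemma greedy_setI (x : X) (Gamma : {fset nat}) : 0 < t -> (0 < #|` Gamma|)%N ->
  (forall i j, i \in Gamma -> j \notin Gamma ->
     t * `|biorth e j x| <= `|biorth e i x|) ->
  greedy_set e x t #|` Gamma| Gamma.
Proof.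
move=> t0; rewrite cardfs_gt0 => /fset0Pn[i0 i0G] xG; split => //.
apply: lb_le_inf; first by exists `|biorth e i0 x|, i0.
move=> _ [i iG <-]; rewrite mulrC -ler_pdivlMr //.
(* The supremum of an empty [S] is the default value 0, so this case is treated apart. *)
set S := [set _ | _ in _]; have [->|/set0P S0] := eqVneq S set0.
  by rewrite sup0 divr_ge0 // ltW.
apply: ge_sup => // _ [j /negP jG <-]; rewrite ler_pdivlMr // mulrC.
exact: xG.
Qed.

Lemma greedy_setE (x : X) (m : nat) (Gamma : {fset nat}) :
  0 < t -> (0 < m)%N -> greedy_set e x t m Gamma ->
  exists mu, [/\ 0 <= mu, forall i, i \in Gamma -> mu <= `|biorth e i x| &
    forall j, j \notin Gamma -> `|biorth e j x| <= mu / t].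
Proof.
move=> t0 m0 [cG tG]; exists (inf [set `|biorth e n x| | n in [set` Gamma]]).
split.
- apply: lb_le_inf; last by move=> _ [n _ <-].
  move: m0; rewrite -cG cardfs_gt0 => /fset0Pn[i iG].
  by exists `|biorth e i x|, i.
- move=> i iG; apply: ge_inf; last by exists i.
  by exists 0 => _ [n _ <-].
- move=> j jG; rewrite ler_pdivlMr // mulrC (le_trans _ tG) // ler_pM2l //.
  (* The supremum in [tG] dominates each coordinate off [Gamma] only because the coordinates are
     bounded. *)
  have [M Mx] := biorth_bounded x.
  apply: ub_le_sup; last by exists j => //; exact/negP.
  by exists M => _ [n _ <-].
Qed.

Lemma indicatorD (a b : nat -> R) (A : {fset nat}) :
  indicator e (fun n => a n + b n) A = indicator e a A + indicator e b A.
Proof.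
by rewrite /indicator -big_split; apply: eq_bigr => n _; rewrite scalerDl.
Qed.

Lemma indicatorZ (c : R) (a : nat -> R) (A : {fset nat}) :
  indicator e (fun n => c * a n) A = c *: indicator e a A.
Proof.
by rewrite /indicator scaler_sumr; apply: eq_bigr => n _; rewrite scalerA.
Qed.

Lemma eq_indicator (a b : nat -> R) (A : {fset nat}) :
  {in A, a =1 b} -> indicator e a A = indicator e b A.
Proof. by move=> ab; apply: eq_big_seq => n /ab ->. Qed.

Lemma span_biorth0 (A : {fset nat}) (y : X) (n : nat) :
  lin_span [set e n | n in [set` A]] y -> n \notin A -> biorth e n y = 0.
Proof.
move=> [k [v [a [vA ->]]]] nA.
(* Each [v i] is some [e j] with [j] in [A], hence equals its own coordinate sum over [A]; by
   linearity so does [y]. *)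
suff -> : \sum_(i < k) a i *: v i =
    \sum_(i < k) a i *: indicator e (biorth e ^~ (v i)) A.
  have -> : \sum_(i < k) a i *: indicator e (biorth e ^~ (v i)) A =
      indicator e (fun n => \sum_(i < k) a i * biorth e n (v i)) A.
    rewrite /indicator; under eq_bigr do rewrite scaler_sumr.
    rewrite exchange_big; apply: eq_bigr => i _; rewrite scaler_suml.
    by apply: eq_bigr => j _; rewrite scalerA.
  by rewrite biorth_indicator // (negPf nA).
apply: eq_bigr => i _; congr (_ *: _); have [j jA <-] := vA i.
apply: (biorth_inj basis) => l; rewrite biorth_indicator // biorth_basis //.
by case: ifP => // /negP lA; case: eqP => // lj; rewrite lj in lA.
Qed.

(** * Consequences of the PCCG inequality *)

Section PCCG.
Variable D : R.
Hypotheses (t0 : 0 < t) (t1 : t <= 1) (D0 : 0 <= D).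
(** Here the greedy condition is stated coordinate by coordinate, a single approximant replaces the
    infimum, and [Gamma] may be empty, which spares the lemmas below a separate case. *)
Hypothesis pccg : forall x c (Gamma B : {fset nat}) (eta : nat -> R),
  (forall i j, i \in Gamma -> j \notin Gamma ->
     t * `|biorth e j x| <= `|biorth e i x|) ->
  (#|` B| <= #|` Gamma|)%N -> signs B eta ->
  `|x - basis_proj e Gamma x| <= D * `|x - c *: indicator e eta B|.

Lemma suppression (x : X) (A : {fset nat}) :
  `|x - indicator e (biorth e ^~ x) A| <= D * `|x|.
Proof.
have [M xM] := biorth_bounded x.
(* The coordinates of [y] are at most [M] in modulus off [A] and at least [2 * M - M] on [A]. Hence
   [A] is greedy for [y]. *)
pose y := x + (2 * M) *: indicator e (fun=> 1) A.
have yE n : biorth e n y = biorth e n x + (if n \in A then 2 * M else 0).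
  rewrite (biorthD basis) (biorthZ basis) (biorth_indicator basis).
  by case: ifP => _; lra.
have -> : x - indicator e (biorth e ^~ x) A = y - basis_proj e A y.
  apply: (biorth_inj basis) => n; rewrite !(biorthB basis) !(biorth_indicator basis) yE.
  by case: ifP => _; lra.
have -> : `|x| = `|y - (2 * M) *: indicator e (fun=> 1) A| by rewrite addrK.
apply: pccg => // [i j iA jA|n _]; last by left.
rewrite !yE iA (negPf jA) addr0 (@le_trans _ _ M) //.
  by rewrite (le_trans _ (xM j)) // ler_piMl.
by have := xM i; rewrite ler_norml => /andP[? ?]; rewrite ger0_norm; lra.
Qed.

(** This is [suppression] of the coordinates in the difference of [B] and [A]. *)
Lemma indicator_sub_le (a : nat -> R) (A B : {fset nat}) :
  A `<=` B -> `|indicator e a A| <= D * `|indicator e a B|.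
Proof.
move=> /fsubsetP AB; apply: le_trans (suppression _ (B `\` A)).
rewrite le_eqVlt; apply/orP; left; apply/eqP; congr `|_|.
apply: (biorth_inj basis) => n; rewrite (biorthB basis) !(biorth_indicator basis) in_fsetD.
by case: (n \in A) (AB n) => [/(_ isT) ->|_]; [|case: (n \in B)] => /=; lra.
Qed.

(* The vectors below are convex combinations of those whose multipliers all
   lie in {0, 1}; the induction removes one intermediate multiplier at a time. *)
Lemma indicator_contract_le (a l : nat -> R) (A : {fset nat}) :
  (forall n, n \in A -> 0 <= l n <= 1) ->
  `|indicator e (fun n => l n * a n) A| <= D * `|indicator e a A|.
Proof.
(* The list [s] covers the indices where [l] may lie strictly between 0 and 1; it is [A] at the
   start. Convexity of the norm keeps the constant [D] unchanged through the induction. *)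
suff H (s : seq nat) : forall l : nat -> R, (forall n, n \in A -> 0 <= l n <= 1) ->
    (forall n, n \in A -> n \notin s -> l n = 0 \/ l n = 1) ->
    `|indicator e (fun n => l n * a n) A| <= D * `|indicator e a A|.
  by move=> l01; apply: (H A) => // n ->.
elim: s => [|k s IH] {}l l01 ls.
  apply: le_trans (@indicator_sub_le a [fset n in A | l n == 1] A _); last first.
    by apply/fsubsetP => n; rewrite !inE => /andP[].
  rewrite le_eqVlt; apply/orP; left; apply/eqP; congr `|_|.
  apply: (biorth_inj basis) => n; rewrite !(biorth_indicator basis) !inE.
  case: ifP => //= nA; case: (ls _ nA) => // ->; first by rewrite mul0r eq_sym oner_eq0.
  by rewrite eqxx mul1r.
have [kA|kA] := boolP (k \in A); last first.
  apply: IH => // n nA ns; apply: ls => //; rewrite inE negb_or ns andbT.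
  by apply: contraNneq kA => <-.
pose l_ (c : R) n := if n == k then c else l n.
have l_le (c : R) : c = 0 \/ c = 1 ->
    `|indicator e (fun n => l_ c n * a n) A| <= D * `|indicator e a A|.
  move=> c01; apply: IH => n nA; rewrite /l_; case: eqP => // nk.
  - by case: c01 => ->; rewrite lexx ler01.
  - exact: l01.
  - by move=> ns; apply: ls; rewrite // inE negb_or ns andbT; apply/eqP.
have -> : indicator e (fun n => l n * a n) A =
    (1 - l k) *: indicator e (fun n => l_ 0 n * a n) A
    + l k *: indicator e (fun n => l_ 1 n * a n) A.
  rewrite -!indicatorZ -indicatorD; apply: eq_indicator => n _; rewrite /l_.
  by case: eqP => [->|_]; ring.
have /andP[lk0 lk1] := l01 k kA.
apply: le_trans (ler_normD _ _) _; rewrite !normrZ !ger0_norm ?subr_ge0 //.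
have := l_le 0 (or_introl erefl); have := l_le 1 (or_intror erefl).
by nra.
Qed.

(** All coordinates of the sum [x] have modulus at most 1, and exactly 1 on [B], so [B] is greedy.
    Projecting it away leaves the [A] part, while the approximant supported on [A] leaves the [B]
    part. *)
Lemma democracy (a b : nat -> R) (A B : {fset nat}) :
  signs A a -> signs B b -> [disjoint A & B] -> (#|` A| <= #|` B|)%N ->
  `|indicator e a A| <= D * `|indicator e b B|.
Proof.
move=> sA sB /fdisjointP AB cAB.
pose x := indicator e a A + indicator e b B.
have xE n : biorth e n x =
    (if n \in A then a n else 0) + (if n \in B then b n else 0).
  by rewrite (biorthD basis) !(biorth_indicator basis).
have -> : indicator e a A = x - basis_proj e B x.
  apply: (biorth_inj basis) => n; rewrite (biorthB basis) !(biorth_indicator basis) xE.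
  by case: (n \in A) (AB n) => [/(_ isT)/negPf ->|_]; [|case: (n \in B)]; lra.
have -> : indicator e b B = x - 1 *: indicator e a A by rewrite /x scale1r addrAC subrr add0r.
apply: pccg => // i j iB jB; rewrite !xE iB (negPf jB) addr0.
have -> : i \in A = false by apply/negP => /AB; rewrite iB.
have -> : `|0 + b i| = 1 by rewrite add0r; case: (sB _ iB) => ->; rewrite ?normrN normr1.
case: ifP => [/sA[]->|_]; by rewrite ?normrN ?normr1 ?normr0 ?mulr1 ?mulr0 ?ler01.
Qed.

(** The summand [D] comes from suppressing the union of [A] and [Gamma]. In the other one, [D ^+ 3]
    collects two contractions and one use of [democracy], [1 + D] bounds a coordinate projection,
    and [1 / t] comes from the bound [mu / t] off [Gamma]. *)
Lemma greedy_bound (x y : X) (A Gamma : {fset nat}) (mu : R) :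
  #|` A| = #|` Gamma| -> 0 <= mu ->
  (forall i, i \in Gamma -> mu <= `|biorth e i x|) ->
  (forall j, j \notin Gamma -> `|biorth e j x| <= mu / t) ->
  (forall n, n \notin A -> biorth e n y = 0) ->
  `|x - basis_proj e Gamma x| <= (D + D ^+ 3 * (1 + D) / t) * `|x - y|.
Proof.
move=> cA mu0 muG Gmu yA; pose z := x - y.
have zE n : n \notin A -> biorth e n z = biorth e n x.
  by move=> nA; rewrite (biorthB basis) yA // subr0.
pose sg n : R := (-1) ^+ (biorth e n x < 0)%R.
have sgs B : signs B sg by move=> n _; rewrite /sg; case: (_ < _); [right|left].
have sgE n : biorth e n x = sg n * `|biorth e n x| by exact: numEsign.
have -> : x - basis_proj e Gamma x =
    (z - indicator e (biorth e ^~ z) (A `|` Gamma))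
    + indicator e (biorth e ^~ x) (A `\` Gamma).
  apply: (biorth_inj basis) => n.
  rewrite (biorthB basis) (biorthD basis) (biorthB basis) !(biorth_indicator basis) !inE.
  have := zE n; rewrite (biorthB basis).
  case: (n \in A) => /= [_|/(_ isT)];
    by case: (n \in Gamma) => /=; lra.
apply: le_trans (ler_normD _ _) _; rewrite mulrDl lerD ?suppression //.
have cAG : #|` A `\` Gamma| = #|` Gamma `\` A|.
  by move: (cardfsID Gamma A) (cardfsID A Gamma); rewrite fsetIC cA => <- /addnI.
(* The coordinates of [x] are those of [mu / t] times the sign vector, scaled by multipliers in
   [0, 1]. If [mu / t] is 0, these coordinates vanish. *)
have Ale : `|indicator e (biorth e ^~ x) (A `\` Gamma)| <=
    mu / t * (D * `|indicator e sg (A `\` Gamma)|).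
  rewrite (@eq_indicator _ (fun n =>
      mu / t * (`|biorth e n x| / (mu / t) * sg n))) => [|n /fsetDP[_ nG]]; last first.
    have [m0|m0] := eqVneq (mu / t) 0.
      by have := Gmu n nG; rewrite m0 mul0r normr_le0 => /eqP.
    by rewrite {1}sgE mulrA mulrCA divff // mulr1 mulrC.
  rewrite indicatorZ normrZ ger0_norm ?divr_ge0 ?(ltW t0) //.
  apply: ler_wpM2l; first by rewrite divr_ge0 ?(ltW t0).
  apply: indicator_contract_le => n /fsetDP[_ nG].
  rewrite divr_ge0 ?divr_ge0 ?(ltW t0) //=.
  have [->|m0] := eqVneq (mu / t) 0; first by rewrite invr0 mulr0.
  by rewrite ler_pdivrMr ?mul1r ?Gmu // lt_neqAle eq_sym m0 divr_ge0 // ltW.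
(* In the reverse direction the multipliers are [mu] over the modulus of the coordinate, and [z]
   agrees with [x] off [A]. A zero coordinate on [Gamma] forces [mu] to be 0. *)
have Gle : mu * `|indicator e sg (Gamma `\` A)| <=
    D * `|indicator e (biorth e ^~ z) (Gamma `\` A)|.
  rewrite -[mu]ger0_norm // -normrZ -indicatorZ.
  rewrite (@eq_indicator _ (fun n =>
      mu / `|biorth e n x| * biorth e n z)) => [|n /fsetDP[nG nA]]; last first.
    rewrite zE // {2}sgE; have [x0|x0] := eqVneq `|biorth e n x| 0.
      have := muG n nG; rewrite x0 => m0.
      by rewrite (le_anti (introT andP (conj m0 mu0))) !mul0r.
    by rewrite [sg n * _]mulrC mulrA divfK.
  apply: indicator_contract_le => n /fsetDP[nG nA].
  rewrite divr_ge0 //=; have [->|x0] := eqVneq `|biorth e n x| 0.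
    by rewrite invr0 mulr0.
  by rewrite ler_pdivrMr ?mul1r ?muG // lt_neqAle eq_sym x0 normr_ge0.
(* The projection is [z] minus the vector bounded by [suppression]. *)
have zle : `|indicator e (biorth e ^~ z) (Gamma `\` A)| <= (1 + D) * `|z|.
  rewrite mulrDl mul1r -[X in `|X|](subKr z).
  by rewrite (le_trans (ler_normB _ _)) // lerD2l suppression.
have dem : `|indicator e sg (A `\` Gamma)| <= D * `|indicator e sg (Gamma `\` A)|.
  apply: democracy; rewrite ?cAG //; apply/fdisjointP => n /fsetDP[nA nG].
  by rewrite !inE nA.
apply: (le_trans Ale); rewrite mulrAC [leRHS]mulrAC ler_pM2r ?invr_gt0 //.
apply: (@le_trans _ _ (D ^+ 2 * (mu * `|indicator e sg (Gamma `\` A)|))).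
  by rewrite expr2 mulrCA -!mulrA ler_wpM2l // mulrCA ler_wpM2l.
rewrite (exprSr D 2) -2!(mulrA (D ^+ 2)) ler_wpM2l ?exprn_ge0 // (le_trans Gle) //.
by rewrite -mulrA ler_wpM2l.
Qed.

End PCCG.

(** * The two implications *)

Lemma t_PCCG_t_greedy : 0 < t -> t <= 1 -> t_PCCG t e -> t_greedy t e.
Proof.
(* Since [K] is at least 1, the inequality also holds for empty [Gamma], where it reads
   [|x| <= K * |x|] and [De] does not apply. *)
move=> t0 t1 [D D0 De]; pose K := 1 + D.
have K0 : 0 < K by rewrite addr_gt0.
have C0 : 0 < K + K ^+ 3 * (1 + K) / t.
  by rewrite addr_gt0 // divr_gt0 // mulr_gt0 ?exprn_gt0 // addr_gt0.
exists (K + K ^+ 3 * (1 + K) / t) => //.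
have pccg x c (Gamma B : {fset nat}) (eta : nat -> R) :
  (forall i j, i \in Gamma -> j \notin Gamma ->
     t * `|biorth e j x| <= `|biorth e i x|) ->
  (#|` B| <= #|` Gamma|)%N -> signs B eta ->
  `|x - basis_proj e Gamma x| <= K * `|x - c *: indicator e eta B|.
  move=> xG cB sB; have [G0|] := posnP #|` Gamma|.
    move: cB; rewrite G0 leqn0 cardfs_eq0 => /eqP ->.
    move/eqP: G0; rewrite cardfs_eq0 => /eqP ->.
    rewrite /basis_proj /indicator !big_seq_fset0 scaler0 subr0.
    by rewrite ler_peMl // lerDl ltW.
  move=> G0; apply: le_trans (De _ _ _ G0 (greedy_setI t0 G0 xG)) _.
  apply: ler_pM; rewrite ?(ltW D0) ?lerDr //; last exact: pccg_error_le.
  by apply: ge_pccg_error.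
move=> x m Gamma m0 xG; have [mu [mu0 muG Gmu]] := greedy_setE t0 m0 xG.
rewrite mulrC -ler_pdivrMr //; apply: ge_sigma => A y cA Ay.
rewrite ler_pdivrMr // mulrC; apply: (@greedy_bound K t0 t1 (ltW K0) pccg _ _ A _ mu) => //.
  by rewrite cA; case: xG.
by move=> n; exact: span_biorth0.
Qed.

End Democracy.

Lemma t_greedy_t_PCCG (R : realType) (X : normedModType R) (e : nat -> X) (t : R) :
  t_greedy t e -> t_PCCG t e.
Proof.
move=> [C C0 Ce]; exists C => // x m Gamma m0 xG.
by rewrite (le_trans (Ce x m Gamma m0 xG)) // ler_pM2l // sigma_le_pccg_error.
Qed.

Theorem corollary1p6 (R : realType) (X : completeNormedModType R)
    (e : nat -> X) (t : R)
    (hX : infinite_dimensional X)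
    (he : schauder_basis e)
    (hnorm : normalized e)
    (ht0 : 0 < t) (ht1 : t <= 1) :
  t_PCCG t e <-> t_greedy t e.
Proof.
split; first exact: t_PCCG_t_greedy.
exact: t_greedy_t_PCCG.
Qed.
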